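(* Let $E\subseteq \mathcal{A}$ and $F\subseteq \mathcal{F}$ be finite sets such that: (1) $\{(\!(0,0)\!),(\!(1,1,1)\!)\}\subseteq E$; (2) for every quiddity cycle $c\in\mathcal{A}$, either $c\in E$ or there exists $f\in F$ with $f\subsetneq c$; (3) every $f\in F$ has at least one entry equal to $1$. Put \[ E' := E\cup \delta^{-1}(\overline{\psi}(E)), \qquad F' := \rho^{-1}(\iota(\psi(F))). \] Then $E'$ and $F'$ are finite sets with $E'\subseteq\mathcal{A}$ and $F'\subseteq\mathcal{F}$, they satisfy properties (1), (2), (3) (with $E',F'$ in place of $E,F$), and \[ \min\{\text{length of } f \mid f\in F\} < \min\{\text{length of } f\mid f\in F'\}. \]
   Context: Let $\mathbb{N}=\{1,2,\dots\}$, $\mathbb{N}_0=\mathbb{N}\cup\{0\}$. For $n\in\mathbb{N}$ let $\mathcal{F}_n:=\mathbb{N}_0^n$ and $\mathcal{F}:=\bigcup_{n\in\mathbb{N}}\mathcal{F}_n$ (finite sequences; the length of $(c_1,\dots,c_n)$ is $n$). Let $\mathcal{D}_n$ be the set of orbits of $\mathcal{F}_n$ under the dihedral group acting on positions (generated by rotation $(c_1,\dots,c_n)\mapsto(c_2,\dots,c_n,c_1)$ and reversal $(c_1,\dots,c_n)\mapsto(c_n,\dots,c_1)$), and $\mathcal{D}:=\bigcup_n\mathcal{D}_n$. Write $(\!(c_1,\dots,c_n)\!)$ for the class of $(c_1,\dots,c_n)$; its elements are called representatives. All notions on $\mathcal{D}$ are via representatives, with positions read cyclically (the last and first positions are adjacent).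 Containment: $d=(d_1,\dots,d_m)\in\mathcal{F}$ is contained in $c\in\mathcal{D}$, written $d\subseteq c$, if there are a representative $(c_1,\dots,c_n)$ of $c$ and $k\in\mathbb{N}_0$ with $c_{k+i}=d_i$ for $i=1,\dots,m$ (indices taken cyclically modulo $n$). $d\subsetneq c$ means $d\subseteq c$ and $d$ is not itself a representative of $c$. Quiddity cycles: $\mathcal{A}\subseteq\mathcal{D}$ is the smallest subset such that $(\!(0,0)\!)\in\mathcal{A}$ and, whenever $(\!(c_1,\dots,c_n)\!)\in\mathcal{A}$ (any representative), also $(\!(c_1+1,1,c_2+1,c_3,\dots,c_n)\!)\in\mathcal{A}$. Maps: $\psi:\mathcal{F}\to\mathcal{F}$, $(c_1,c_2,\dots,c_n)\mapsto(c_1+2,1,c_2+2,1,\dots,c_n+2,1)$; it induces $\overline{\psi}:\mathcal{A}\to\mathcal{D}$, $(\!(c_1,\dots,c_n)\!)\mapsto(\!(c_1+2,1,\dots,c_n+2,1)\!)$. For $c=(c_1,1,c_3,1,\dots)\in\mathcal{F}_n$ (all even-position entries equal $1$), $\iota(c):=(1,c_1,1,c_3,1,\dots)\in\mathcal{F}_{n+1}$. The map $\rho:\mathcal{F}\to\mathcal{F}$ sends $c=(c_1,\dots,c_n)$ to the sequence obtained by repeatedly applying the following replacements until none applies: (i) $(\dots,c_i,c_{i+1},\dots)\to(\dots,c_i+1,1,c_{i+1}+1,\dots)$ if $c_i,c_{i+1}>1$; (ii) $(c_1,\dots)\to(1,c_1+1,\dots)$ if $c_1>1$; (iii) $(\dots,c_n)\to(\dots,c_n+1,1)$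 if $c_n>1$. The map $\delta:\mathcal{D}\setminus\{(\!(0,0)\!),(\!(1,1,1)\!)\}\to\mathcal{D}$ sends $c$ to the class obtained by repeatedly applying, until none applies: (i) $(\!(\dots,c_i,c_{i+1},\dots)\!)\mapsto(\!(\dots,c_i+1,1,c_{i+1}+1,\dots)\!)$ if $c_i,c_{i+1}>1$; (ii) $(\!(c_1,\dots,c_n)\!)\mapsto(\!(c_1+1,c_2,\dots,c_{n-1},c_n+1,1)\!)$ if $c_1,c_n>1$. Preimages $\rho^{-1}(X)=\{f\in\mathcal{F}:\rho(f)\in X\}$, $\delta^{-1}(Y)=\{c:\delta(c)\in Y\}$. *)

(* Defs.v *)
From Stdlib Require Import Relations.
From mathcomp Require Import all_boot all_order.
From mathcomp Require Import boolp classical_sets functions cardinality.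
From mathcomp Require Import zify.

Set Implicit Arguments.
Unset Strict Implicit.
Unset Printing Implicit Defensive.

Local Open Scope nat_scope.
Local Open Scope classical_set_scope.

(* [calF] is the set of finite sequences of length n >= 1. *)
Definition calF : set (seq nat) := [set s | s != [::]].

(* The dihedral orbit of [c].  Both generators have finite order, so closing
   under rotation and reversal alone already gives the whole orbit. *)
Inductive dihedral (c : seq nat) : seq nat -> Prop :=
| dihedral_refl : dihedral c c
| dihedral_rot d : dihedral c d -> dihedral c (rot 1 d)
| dihedral_rev d : dihedral c d -> dihedral c (rev d).

(* The class (( c )) is the orbit itself, as a set of sequences; hence
   "[s] is a representative of [C]" is literally [C s]. *)
Definition cls (c : seq nat) : set (seq nat) := [set d | dihedral c d].

Definition calD : set (set (seq nat)) := cls @` calF.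

(* With 0-based [nth], position k + i (1 <= i <= m) of the text becomes
   k + j (0 <= j < m).  The length of [d] may exceed that of [C], in which
   case [d] winds around the cycle. *)
Definition contained (d : seq nat) (C : set (seq nat)) : Prop :=
  exists2 c, C c & exists k, forall j, j < size d ->
    nth 0 d j = nth 0 c ((k + j) %% size c).

Definition properly_contained (d : seq nat) (C : set (seq nat)) : Prop :=
  contained d C /\ ~ C d.

Inductive calA : set (set (seq nat)) :=
| calA_base : calA (cls [:: 0; 0])
| calA_step a b s :
    calA (cls [:: a, b & s]) -> calA (cls [:: a.+1, 1, b.+1 & s]).

Definition psi (c : seq nat) : seq nat :=
  flatten [seq [:: x.+2; 1] | x <- c].

(* [xget [::] C] is some representative of [C]; the value does not depend on
   it, see [psibar_cls]. *)
Definition psibar (C : set (seq nat)) : set (seq nat) :=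
  cls (psi (xget [::] C)).

(* Only used on sequences all of whose even-position entries are 1. *)
Definition iota_map (c : seq nat) : seq nat := 1 :: c.

(* [y] results from [x] by applying [R] until it no longer applies. *)
Definition normal_form T (R : T -> T -> Prop) (x y : T) : Prop :=
  clos_refl_trans T R x y /\ forall z, ~ R y z.

Inductive rho_step : seq nat -> seq nat -> Prop :=
| rho_mid p a b q : 1 < a -> 1 < b ->
    rho_step (p ++ [:: a, b & q]) (p ++ [:: a.+1, 1, b.+1 & q])
| rho_first a q : 1 < a -> rho_step (a :: q) [:: 1, a.+1 & q]
| rho_last p a : 1 < a -> rho_step (rcons p a) (p ++ [:: a.+1; 1]).

(* Normal forms exist and are unique, see [rhoP]. *)
Definition rho (c : seq nat) : seq nat :=
  xget [::] [set d | normal_form rho_step c d].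

(* In a cycle of length 1 the first and last entries coincide, and the
   wrap-around rule increments that entry once from each side. *)
Inductive delta_step : set (seq nat) -> set (seq nat) -> Prop :=
| delta_mid p a b q : 1 < a -> 1 < b ->
    delta_step (cls (p ++ [:: a, b & q])) (cls (p ++ [:: a.+1, 1, b.+1 & q]))
| delta_wrap a m b : 1 < a -> 1 < b ->
    delta_step (cls (a :: rcons m b)) (cls (a.+1 :: m ++ [:: b.+1; 1]))
| delta_wrap1 a : 1 < a -> delta_step (cls [:: a]) (cls [:: a.+2; 1]).

(* Normal forms exist and are unique, see [deltaP]. *)
Definition delta (C : set (seq nat)) : set (seq nat) :=
  xget set0 [set C' | normal_form delta_step C C'].

Definition dom_delta : set (set (seq nat)) :=
  calD `\` [set cls [:: 0; 0]; cls [:: 1; 1; 1]].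

Definition rho_preimage (X : set (seq nat)) : set (seq nat) :=
  [set f | calF f /\ X (rho f)].

Definition delta_preimage (Y : set (set (seq nat))) : set (set (seq nat)) :=
  [set C | dom_delta C /\ Y (delta C)].

Definition is_min (S : set nat) (m : nat) : Prop := S m /\ lbound S m.

Definition property1 (E : set (set (seq nat))) : Prop :=
  [set cls [:: 0; 0]; cls [:: 1; 1; 1]] `<=` E.

Definition property2 (E : set (set (seq nat))) (F : set (seq nat)) : Prop :=
  forall C, calA C -> E C \/ exists2 f, F f & properly_contained f C.

Definition property3 (F : set (seq nat)) : Prop :=
  forall f, F f -> 1 \in f.

(* Well-definedness of [psibar], [rho] and [delta]. *)

Lemma dihedral_trans a b c : dihedral a b -> dihedral b c -> dihedral a c.
Proof.
by move=> ab; elim=> // d _ ad; [apply: dihedral_rot | apply: dihedral_rev].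
Qed.

Lemma dihedral_rotn n c : dihedral c (rot n c).
Proof.
have [nc|/ltnW nc] := leqP n (size c); last first.
  by rewrite rot_oversize//; exact: dihedral_refl.
elim: n nc => [|n IH] nc; first by rewrite rot0; exact: dihedral_refl.
by rewrite -addn1 addnC rotD ?add1n//; apply/dihedral_rot/IH/ltnW.
Qed.

Lemma dihedral_sym a b : dihedral a b -> dihedral b a.
Proof.
elim=> [|d _ da|d _ da]; first exact: dihedral_refl.
- by apply: dihedral_trans da; rewrite -{2}(rotK 1 d); exact: dihedral_rotn.
- by apply: dihedral_trans da; rewrite -{2}(revK d);
    exact/dihedral_rev/dihedral_refl.
Qed.

Lemma clsP a b : cls a = cls b <-> dihedral a b.
Proof.
split=> [ab|ab].
  by rewrite -[dihedral a b]/(cls a b) ab; exact: dihedral_refl.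
rewrite predeqE => d; split; last exact: dihedral_trans.
exact/dihedral_trans/dihedral_sym.
Qed.

Lemma cls_rot n c : cls (rot n c) = cls c.
Proof. by apply/esym/clsP/dihedral_rotn. Qed.

Lemma cls_rev c : cls (rev c) = cls c.
Proof. by apply/esym/clsP/dihedral_rev/dihedral_refl. Qed.

Lemma xget_cls c : dihedral c (xget [::] (cls c)).
Proof. exact: (@xgetI _ [::] (cls c) _ (dihedral_refl c)). Qed.

Lemma cls_invariant T (g : seq nat -> T) :
  (forall s, g (rot 1 s) = g s) -> (forall s, g (rev s) = g s) ->
  forall c, g (xget [::] (cls c)) = g c.
Proof.
move=> grot grev c; have := xget_cls c.
by move: (xget _ _) => d; elim=> // e _ <-; rewrite ?grot ?grev.
Qed.

Lemma psi_rcons s a : psi (rcons s a) = psi s ++ [:: a.+2; 1].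
Proof. by rewrite /psi map_rcons flatten_rcons. Qed.

Lemma psi_rev s : 1 :: psi (rev s) = rcons (rev (psi s)) 1.
Proof.
elim: s => //= a s IH.
by rewrite rev_cons psi_rcons -cat_cons IH !rev_cons cat_rcons -!cats1 -!catA.
Qed.

Lemma psibar_cls c : psibar (cls c) = cls (psi c).
Proof.
apply: (cls_invariant (g := cls \o psi)) => [[|a s]|s] //=.
  by rewrite rot1_cons psi_rcons -(cls_rot 2 (psi (a :: s))) /rot /= drop0 take0.
case/lastP: s => // s a; rewrite rev_rcons psi_rcons.
rewrite -(cls_rev (psi s ++ _)) rev_cat -(cls_rot 1 (rev _ ++ _)).
by rewrite -[psi (_ :: _)]/([:: a.+2, 1 & psi (rev s)]) psi_rev rot1_cons.
Qed.

Lemma normal_formP T (R : T -> T -> Prop) (N : T -> T) (m : T -> nat) :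
  (forall x y, R x y -> N x = N y) ->
  (forall x y, R x y -> m y < m x) ->
  (forall x, (forall y, ~ R x y) -> N x = x) ->
  forall x y, normal_form R x y <-> y = N x.
Proof.
move=> RN Rm nfN.
have clN x y : clos_refl_trans T R x y -> N x = N y.
  by elim=> [? ? /RN|//|? ? ? _ -> _ ->].
have ex_nf x : exists y, normal_form R x y.
  have [n] := ubnP (m x); elim: n x => // n IH x mx.
  have [[y Rxy]|nR] := pselect (exists y, R x y); last first.
    by exists x; split=> [|z Rxz]; [exact: rt_refl | apply: nR; exists z].
  have [z [yz nz]] := IH y (leq_trans (Rm _ _ Rxy) mx).
  by exists z; split=> //; apply: rt_trans yz; exact: rt_step.
move=> x y; split=> [[/clN -> /nfN ->] //|->].
by have [z [xz nz]] := ex_nf x; rewrite (clN _ _ xz) (nfN _ nz).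
Qed.

Definition bigs (s : seq nat) : seq bool := [seq 1 < x | x <- s].

(* All replacements at once, [l] and [r] telling whether the neighbours of the
   two ends are greater than 1; the 1 due on the right of [s] is left out. *)
Fixpoint fill (l r : bool) (s : seq nat) : seq nat :=
  if s is a :: s' then
    nseq (l && (1 < a)) 1 ++
    (if 1 < a then a + l + head r (bigs s') else a) :: fill (1 < a) r s'
  else [::].

Definition fill_full (l r : bool) (s : seq nat) : seq nat :=
  fill l r s ++ nseq (last l (bigs s) && r) 1.

Definition rho_nf (s : seq nat) : seq nat :=
  if s is [::] then [::] else fill_full true true s.

Definition cyc_fill (s : seq nat) : seq nat :=
  fill (last false (bigs s)) (head false (bigs s)) s.

Lemma fill_cat l r p q :
  fill l r (p ++ q) =
  fill l (head r (bigs q)) p ++ fill (last l (bigs p)) r q.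
Proof.
by elim: p l => //= a p IH l; rewrite IH -catA /=; case: p {IH}.
Qed.

Lemma fill_mid l r p a b q : 1 < a -> 1 < b ->
  fill l r (p ++ [:: a, b & q]) = fill l r (p ++ [:: a.+1, 1, b.+1 & q]).
Proof.
move=> a1 b1; rewrite !fill_cat /=.
by rewrite a1 b1 !ltnS !(ltnW a1) !(ltnW b1) !andbT !addn0 !addn1 !addSn.
Qed.

Lemma size_fill l r s : size s <= size (fill l r s).
Proof.
by elim: s l => //= a s IH l; rewrite size_cat /= addnS ltnS;
  exact: leq_trans (IH _) (leq_addl _ _).
Qed.

Lemma rho_step_nf x y : rho_step x y -> rho_nf x = rho_nf y.
Proof.
case=> [p a b q a1 b1|a q a1|p a a1].
- rewrite /rho_nf /fill_full /bigs !map_cat !last_cat (fill_mid _ _ _ _ a1 b1) /=.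
  by rewrite b1 (ltnW b1 : 1 < b.+1); case: p.
- by rewrite /= /fill_full /= a1 ltnS (ltnW a1) /= !addn0 addn1 addSn.
- have -> : rho_nf (rcons p a) = fill_full true true (rcons p a) by case: p.
  have -> : rho_nf (p ++ [:: a.+1; 1]) = fill_full true true (p ++ [:: a.+1; 1]).
    by case: p.
  rewrite -cats1 /fill_full /bigs !map_cat !last_cat !fill_cat /=.
  by rewrite a1 ltnS (ltnW a1) /= !addn0 addn1 addSn -!catA.
Qed.

Lemma fill_id l r s :
  ~~ (l && head r (bigs s)) -> ~~ (r && last l (bigs s)) ->
  (forall p a b q, s = p ++ [:: a, b & q] -> ~~ ((1 < a) && (1 < b))) ->
  fill l r s = s.
Proof.
elim: s l => //= a s IH l nl nr ns.
rewrite IH //; last 2 first.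
- case: s ns nr {IH} => [|b s] ns /=; first by rewrite andbC.
  by move=> _; exact: (ns [::] a b s).
- by move=> p x y q E; apply: (ns (a :: p) x y q); rewrite E.
rewrite (negbTE nl) /=; case: ifP => // a1; move: nl; rewrite a1 andbT => /negbTE->.
suff -> : head r (bigs s) = false by rewrite !addn0.
case: s ns nr {IH} => [|b s] ns /=; first by rewrite a1 andbT => /negbTE.
by move=> _; have := ns [::] a b s erefl; rewrite a1 => /negbTE.
Qed.

Lemma rho_nf_id x : (forall y, ~ rho_step x y) -> rho_nf x = x.
Proof.
case: x => // a s nx; rewrite /rho_nf /fill_full.
have nl : 1 < last a s = false.
  apply/negP => l1; apply: (nx (belast a s ++ [:: (last a s).+1; 1])).
  by rewrite lastI; exact: rho_last.
have lE : last true (bigs (a :: s)) = (1 < last a s) by rewrite /= last_map.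
rewrite lE nl cats0 fill_id//.
- by apply/negP => /= a1; exact: nx (rho_first _ a1).
- by rewrite lE nl.
- move=> p x y q E; apply/negP => /andP[x1 y1].
  by apply: nx; rewrite E; exact: rho_mid.
Qed.

Lemma size_rho_nf x : size x <= size (rho_nf x).
Proof.
case: x => // a s.
by rewrite /rho_nf /fill_full size_cat (leq_trans (size_fill true true _)) ?leq_addr.
Qed.

Lemma rhoP c d : normal_form rho_step c d <-> d = rho c.
Proof.
have H : forall x y, normal_form rho_step x y <-> y = rho_nf x.
  apply: (normal_formP (m := fun x => size (rho_nf x) - size x)) => x y.
  - exact: rho_step_nf.
  - move=> xy; rewrite (rho_step_nf xy).
    have E : size y = (size x).+1.
      case: xy => [p a b q _ _|//|p a _]; rewrite ?size_rcons !size_cat /=; lia.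
    have := size_rho_nf y; lia.
  - exact: rho_nf_id.
suff -> : rho c = rho_nf c by exact: H.
by apply: xget_unique => [|y]; [apply/H | move=> /H].
Qed.

Lemma cyc_fill_rot s : cls (cyc_fill (rot 1 s)) = cls (cyc_fill s).
Proof.
case: s => // a s; rewrite rot1_cons.
pose A := 1 < a; pose X := fill (last A (bigs s)) (head A (bigs s)) [:: a].
have -> : cyc_fill (a :: s) = X ++ fill A A s.
  by rewrite /cyc_fill -[a :: s]/([:: a] ++ s) fill_cat.
have -> : cyc_fill (rcons s a) = fill A A s ++ X.
  rewrite /cyc_fill -cats1 fill_cat /bigs map_cat last_cat -/(bigs s).
  by congr (fill _ _ _ ++ fill _ _ _); case: s {X}.
by rewrite -(cls_rot (size X) (X ++ _)) rot_size_cat.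
Qed.

Lemma fill_full_rcons l r s a :
  fill_full l r (rcons s a) =
  fill l (1 < a) s ++ nseq (last l (bigs s) && (1 < a)) 1 ++
  (if 1 < a then a + last l (bigs s) + r else a) :: nseq ((1 < a) && r) 1.
Proof.
by rewrite /fill_full -cats1 /bigs map_cat last_cat fill_cat /= -!catA.
Qed.

Lemma fill_full_rev l r s :
  fill_full r l (rev s) = rev (fill_full l r s).
Proof.
elim: s l r => [|a s IH] l r; first by rewrite /fill_full /= andbC rev_nseq.
rewrite rev_cons fill_full_rcons catA -/(fill_full r (1 < a) (rev s)) IH.
rewrite {2}/fill_full /= -/(bigs s) -!catA rev_cat rev_nseq cat_cons.
rewrite rev_cons cat_rcons andbC; congr (_ ++ _ :: _).
suff -> : last r (bigs (rev s)) = head r (bigs s) by case: ifP => // _; lia.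
by case: s {IH} => //= b s; rewrite rev_cons /bigs map_rcons last_rcons.
Qed.

Lemma cyc_fill_rev s : cls (cyc_fill (rev s)) = cls (cyc_fill s).
Proof.
case: s => // a s; set t := a :: s; set l := last false (bigs t).
set h := head false (bigs t).
have := fill_full_rev l h t; rewrite /fill_full.
have -> : last h (bigs (rev t)) = h.
  by rewrite /h rev_cons /bigs map_rcons last_rcons.
have -> : last l (bigs t) = l by [].
have -> : fill h l (rev t) = cyc_fill (rev t).
  rewrite /cyc_fill; congr fill.
    by rewrite /h rev_cons /bigs map_rcons last_rcons.
  by rewrite /l /t (lastI a s) rev_rcons /= /bigs map_rcons last_rcons.
rewrite -/(cyc_fill t).
have [u ->] : exists u, cyc_fill t = nseq (l && h) 1 ++ u by eexists.
rewrite [h && l]andbC; case: (l && h); last by rewrite /= !cats0 => ->; exact: cls_rev.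
rewrite [nseq _ _]/= !cats1 cat1s rev_rcons rev_cons -rcons_cons.
case/rcons_inj => ->.
by rewrite -(cls_rev (1 :: u)) rev_cons -rot1_cons cls_rot.
Qed.

Definition is_cls (C : set (seq nat)) : bool := `[< exists s, C = cls s >].

Definition delta_nf (C : set (seq nat)) : set (seq nat) :=
  if is_cls C then cls (cyc_fill (xget [::] C)) else C.

Lemma delta_nf_cls s : delta_nf (cls s) = cls (cyc_fill s).
Proof.
rewrite /delta_nf ifT; last by apply/asboolP; exists s.
apply: (cls_invariant (g := cls \o cyc_fill)); first exact: cyc_fill_rot.
exact: cyc_fill_rev.
Qed.

Lemma dihedral_size s t : dihedral s t -> size t = size s.
Proof. by elim=> // d _; rewrite ?size_rot ?size_rev. Qed.

Definition delta_gap (s : seq nat) : nat := size (cyc_fill s) - size s.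

Lemma delta_gap_cls s : delta_gap (xget [::] (cls s)) = delta_gap s.
Proof.
apply: cls_invariant => {}s; rewrite /delta_gap ?size_rot ?size_rev.
  by have /clsP/dihedral_size-> := cyc_fill_rot s.
by have /clsP/dihedral_size-> := cyc_fill_rev s.
Qed.

Lemma delta_stepP C C' : delta_step C C' -> exists s t,
  [/\ C = cls s, C' = cls t, size t = (size s).+1
    & cls (cyc_fill s) = cls (cyc_fill t)].
Proof.
case=> [p a b q a1 b1|a m b a1 b1|a a1]; do 2 eexists; split; try by [].
- by rewrite !size_cat /= !addnS.
- rewrite /cyc_fill (fill_mid _ _ _ _ a1 b1) /bigs !map_cat !last_cat /=.
  by rewrite b1 (ltnW b1 : 1 < b.+1); case: p => //=; rewrite a1 (ltnW a1 : 1 < a.+1).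
- by rewrite /= size_cat size_rcons /= addn2.
- have a2 : 1 < a.+1 := ltnW a1; have b2 : 1 < b.+1 := ltnW b1.
  set w := a + 1 + head true (bigs m) :: fill true true m ++
    nseq (last true (bigs m)) 1 ++ [:: b + last true (bigs m) + 1].
  have -> : cyc_fill (a :: rcons m b) = 1 :: w.
    rewrite /cyc_fill -cats1 /= /bigs map_cat last_cat /= a1 b1 fill_cat /= b1.
    by rewrite andbT -/(bigs m); case: m @w.
  suff -> : cyc_fill (a.+1 :: m ++ [:: b.+1; 1]) = rcons w 1.
    by rewrite -rot1_cons cls_rot.
  rewrite /cyc_fill /= /bigs map_cat last_cat /= a2 fill_cat /= b2.
  rewrite andbT -/(bigs m) /w -cats1 !addn0 addn1 addSn /= -!catA /= addn1 addSn.
  by case: m @w.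
- by rewrite /cyc_fill /= a1 -(cls_rot 1 [:: _; _]) /= /rot /= !addn0 !addn1.
Qed.

Lemma deltaP C C' : normal_form delta_step C C' <-> C' = delta C.
Proof.
have H : forall x y, normal_form delta_step x y <-> y = delta_nf x.
  apply: (normal_formP (m := delta_gap \o xget [::])) => [x y|x y|x nx].
  - by move=> /delta_stepP[s [t [-> -> _ st]]]; rewrite !delta_nf_cls.
  - move=> /delta_stepP[s [t [-> -> ts /clsP/dihedral_size st]]] /=.
    rewrite !delta_gap_cls /delta_gap st ts.
    have := size_fill (last false (bigs t)) (head false (bigs t)) t.
    rewrite -/(cyc_fill t) st ts; lia.
  - have [[s xs]|nc] := pselect (exists s, x = cls s); last first.
      by rewrite /delta_nf ifF//; apply/asboolP.
    move: nx; rewrite xs delta_nf_cls => nx; congr cls.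
    rewrite /cyc_fill; case: s {xs} nx => // a s nx.
    have wrap : ~~ ((1 < last a s) && (1 < a)).
      apply/negP => /andP[]; case/lastP: s nx => [|m b] nx /=.
        by move=> _ a1; exact: nx (delta_wrap1 a1).
      by rewrite last_rcons => b1 a1; exact: nx (delta_wrap m a1 b1).
    apply: fill_id => [||p u v q E].
    + by rewrite /= last_map.
    + by rewrite /= last_map andbC.
    + apply/negP => /andP[u1 v1]; move: nx; rewrite E => nx.
      exact: nx (delta_mid p q u1 v1).
suff -> : delta C = delta_nf C by exact: H.
by apply: xget_unique => [|y]; [apply/H | move=> /H].
Qed.

(* Main.v *)
Require Import Defs.
From Stdlib Require Import Relations.
From mathcomp Require Import all_boot all_order.
From mathcomp Require Import boolp classical_sets functions cardinality.
From mathcomp Require Import zify.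

(* Glueing a triangle to every edge of a triangulated polygon [e] gives
   [psi e], and the cycles [s] with [delta s = psi e] are obtained by glueing
   triangles to some of the edges only; hence they are quiddity cycles when
   [e] is one.  Conversely, cutting all the ears off a quiddity cycle other
   than (0,0) and (1,1,1) leaves a quiddity cycle [e] with [delta s = psi e].
   If [f] is a proper window of this [e], the part of [s] lying over the
   window [1 :: psi f] of [psi e] is an [f'] with [rho f' = 1 :: psi f].  As
   some entry of [f] is 1, any such [f'] must retain one of the inserted 1s,
   besides one entry for each entry of [f]; so [f'] is longer than [f]. *)

Local Open Scope nat_scope.
Local Open Scope classical_set_scope.

(** * Orbits of [psi e] and of filled cycles *)

Lemma dihedral_perm s t : dihedral s t -> perm_eq t s.
Proof.
by elim=> // d _; apply: perm_trans; rewrite ?perm_rot ?perm_rev.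
Qed.

Lemma psi_rot s : psi (rot 1 s) = rot 2 (psi s).
Proof. by case: s => // a s; rewrite rot1_cons psi_rcons /rot /= drop0 take0. Qed.

Lemma rev_psi s : rev (psi s) = rotr 1 (psi (rev s)).
Proof.
apply: (canRL (rotK 1)); have := psi_rev s.
case/lastP: s => // s a; rewrite psi_rcons rev_cat /= => -[->].
by rewrite rot1_cons.
Qed.

(** The inserted 1s sit at every second position, so a cut of the cycle falls either before an entry
    of [e] or before an inserted 1. *)
Lemma dihedral_psi e x : dihedral (psi e) x ->
  exists2 e', dihedral e e' & x = psi e' \/ x = rotr 1 (psi e').
Proof.
elim=> [|_ _ [e' ee' [] ->]|_ _ [e' ee' [] ->]].
- by exists e; [exact: dihedral_refl | left].
- exists (rot 1 e'); first exact: dihedral_rot.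
  right; rewrite psi_rot; case: e' {ee'} => // a e'.
  by rewrite -[2]/(1 + 1) rotD ?rotK.
- by exists e' => //; left; rewrite rotrK.
- exists (rev e'); first exact: dihedral_rev.
  by right; rewrite rev_psi.
- exists (rev e'); first exact: dihedral_rev.
  by left; rewrite rev_rotr rev_psi rotrK.
Qed.

Lemma dihedral_psi1 e w : dihedral (psi e) (1 :: w) ->
  exists2 e', dihedral e e' & psi e' = rcons w 1.
Proof.
case/dihedral_psi => e' ee' [] E; first by case: e' E {ee'}.
by exists e' => //; rewrite -rot1_cons E rotrK.
Qed.

Lemma psi_inj : injective psi.
Proof. by elim=> [|a s IH] [|b t] //= [-> /IH->]. Qed.

(* [joined s] holds when [cyc_fill] inserts a 1 between the last and the first
   entries; that 1 then comes first in [cyc_fill s]. *)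
Definition joined s := last false (bigs s) && head false (bigs s).

Lemma last_bigs_rev b s : s != [::] ->
  last b (bigs (rev s)) = head false (bigs s).
Proof. by case: s => // a s _; rewrite rev_cons /bigs map_rcons last_rcons. Qed.

Lemma head_bigs_rev s : head false (bigs (rev s)) = last false (bigs s).
Proof.
by case/lastP: s => // s a; rewrite rev_rcons /bigs map_rcons last_rcons.
Qed.

Lemma joined_rev s : joined (rev s) = joined s.
Proof.
by case: s => // a s; rewrite /joined last_bigs_rev // head_bigs_rev andbC.
Qed.

Lemma cyc_fill_rot1 s : cyc_fill (rot 1 s) = rot (joined s).+1 (cyc_fill s).
Proof.
case: s => // a s; rewrite rot1_cons /cyc_fill -cats1 fill_cat.
rewrite /bigs map_cat last_cat -/(bigs s) /joined /=.
have -> : head false (bigs s ++ [:: 1 < a]) = head (1 < a) (bigs s) by case: s.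
by case: (_ && _) => //=; rewrite /rot /= drop0 take0 -?catA.
Qed.

Lemma rev_cyc_fill s : rev (cyc_fill s) = rot (joined s) (cyc_fill (rev s)).
Proof.
have [->|s0] := eqVneq s [::]; first by [].
have := fill_full_rev (last false (bigs s)) (head false (bigs s)) s.
have nE l : last l (bigs s) = last false (bigs s) by case: (s) s0.
rewrite /fill_full nE last_bigs_rev // -{1}(last_bigs_rev false s s0).
rewrite -{1}(head_bigs_rev s) -![fill _ _ _]/(cyc_fill _).
rewrite [in nseq (head _ _ && _)]andbC.
rewrite -/(joined s).
have: exists v, cyc_fill s = nseq (joined s) 1 ++ v by case: (s) s0 => // a t _; eexists.
have: exists u, cyc_fill (rev s) = nseq (joined s) 1 ++ u.
  rewrite -joined_rev; have: rev s != [::] by rewrite -size_eq0 size_rev size_eq0.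
  by case: (rev s) => // a t _; eexists.
case: (joined s) => -[u ->] [v ->] /=; last by rewrite !cats0 rot0 => ->.
rewrite !cats1 rev_cons rev_rcons => -[].
by move=> /rcons_inj[->]; rewrite rot1_cons rev_cons.
Qed.

(** The filled cycle can also be cut between an inserted 1 and the entry after it; [cyc_fill] itself
    never yields that cut, hence the second alternative. *)
Lemma dihedral_cyc_fill s x : dihedral (cyc_fill s) x ->
  exists2 t, dihedral s t &
    x = cyc_fill t \/ joined t /\ x = rot 1 (cyc_fill t).
Proof.
elim=> [|_ _ [t st [->|[jt ->]]]|_ _ [t st [->|[jt ->]]]].
- by exists s; [exact: dihedral_refl | left].
- have [jt|jt] := boolP (joined t); first by exists t => //; right.
  exists (rot 1 t); first exact: dihedral_rot.
  by left; rewrite cyc_fill_rot1 (negbTE jt).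
- exists (rot 1 t); first exact: dihedral_rot.
  left; rewrite cyc_fill_rot1 jt -rotD //.
  by case: t jt {st} => // a t; rewrite /joined /cyc_fill /= => ->.
- exists (rev t); first exact: dihedral_rev.
  rewrite rev_cyc_fill joined_rev.
  by case: (joined t); [right | left; rewrite rot0].
- exists (rev t); first exact: dihedral_rev.
  left; have := rev_cyc_fill (rev t).
  by rewrite joined_rev jt revK => <-; rewrite revK.
Qed.

Lemma cyc_fill_align s e : e != [::] -> cls (cyc_fill s) = cls (psi e) ->
  exists2 t, dihedral s t & rcons (cyc_fill t) 1 = 1 :: psi e.
Proof.
case/lastP: e => // e z _ /clsP se.
have := dihedral_trans se (dihedral_rotn (size (psi e)).+1 _).
have -> : rot (size (psi e)).+1 (psi (rcons e z)) = 1 :: psi e ++ [:: z.+2].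
  by rewrite psi_rcons -(cat1s z.+2) catA -addn1 -(size_cat _ [:: z.+2]) rot_size_cat.
(* In the second alternative the sequence would end in an inserted 1, but it ends in [z.+2]. *)
case/dihedral_cyc_fill => t st [E|[jt E]]; last first.
  have [u tu] : exists u, cyc_fill t = 1 :: u.
    move: jt; case: t {E st} => // a t.
    by rewrite /joined /cyc_fill /= => ->; eexists.
  move: E; rewrite tu rot1_cons cats1 -rcons_cons.
  by case/rcons_inj.
by exists t => //; rewrite -E psi_rcons rcons_cons rcons_cat.
Qed.

(** * Closed forms of [delta] and [rho] *)

(** Each replacement preserves the class of [cyc_fill], and [cyc_fill] fixes a sequence to which no
    replacement applies. *)
Lemma delta_cls s : delta (cls s) = cls (cyc_fill s).
Proof.
have [sd nd] := (deltaP (cls s) _).2 erefl.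
suff [t [dE <- nt]] : exists t, [/\ delta (cls s) = cls t,
    cls (cyc_fill t) = cls (cyc_fill s) & cyc_fill t = t] by rewrite nt.
have [t [dE ts]] : exists t, delta (cls s) = cls t /\
    cls (cyc_fill t) = cls (cyc_fill s).
  move: sd => /(@clos_rt_rtn1 _ _ _ _) sd.
  elim: sd => [|D1 D2 /delta_stepP[u [v [-> -> _ uv]]] _].
    by exists s.
  move=> [t [/(congr1 delta_nf)]]; rewrite !delta_nf_cls uv => <- tE.
  by exists v; rewrite tE.
exists t; split => //; rewrite dE in nd.
have nwrap : ~~ (head false (bigs t) && last false (bigs t)).
  apply/negP; case: t nd {dE ts} => // a t nd /= /andP[a1].
  case/lastP: t nd => [|t b] nd; first by move=> _; exact: nd (delta_wrap1 a1).
  by rewrite /bigs map_rcons last_rcons => b1; exact: nd (delta_wrap t a1 b1).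
apply: fill_id => [||p a b q E].
- by move: nwrap; rewrite andbC; case: (t).
- by move: nwrap; case: (t).
- apply/negP => /andP[a1 b1]; move: nd; rewrite E => nd.
  exact: nd (delta_mid p q a1 b1).
Qed.

Lemma rhoE c : rho c = rho_nf c.
Proof.
have [cd /rho_nf_id nd] := (rhoP c _).2 erefl.
by rewrite -{1}nd; elim: cd => [x y /rho_step_nf|x|x y z _ <- _ <-].
Qed.

(** * Glueing triangles to some edges of a quiddity cycle *)

Lemma calA_cls C : calA C -> exists s, C = cls s /\ 1 < size s.
Proof. by case=> [|a b s _]; eexists; split. Qed.

Lemma calA_size s : calA (cls s) -> 1 < size s.
Proof. by case/calA_cls => t [/clsP/dihedral_size-> ]. Qed.

Lemma calA_glue p a b q : calA (cls (p ++ [:: a, b & q])) ->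
  calA (cls (p ++ [:: a.+1, 1, b.+1 & q])).
Proof.
by rewrite -(cls_rot (size p)) rot_size_cat => /calA_step;
  rewrite -(cls_rot (size p) (p ++ _)) rot_size_cat.
Qed.

Lemma calA_glue_wrap a m b : calA (cls (a :: rcons m b)) ->
  calA (cls [:: 1, a.+1 & rcons m b.+1]).
Proof.
have := @calA_step b a m.
by rewrite -(cls_rot 1 [:: b, a & m]) -(cls_rot 1 [:: b.+1, _ & _]) !rot1_cons.
Qed.

(* The triangles are glued from left to right: [p] has been treated, [x :: e]
   has not, and [l] (resp. [r]) tells that the edge on the left of [x] (resp.
   on the right of [last x e]) remains free. *)
Lemma unfill_calA l r p x e u : head false (bigs u) ->
  rcons (fill l r u) 1 = nseq l 1 ++ psi (x :: e) ->
  calA (cls (p ++ rcons (belast (x + ~~ l) e) (last (x + ~~ l) e + ~~ r))) ->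
  calA (cls (p ++ u)).
Proof.
have [n] := ubnP (size u); elim: n l p x e u => // n IH l p x e [|a u] // un /=.
move=> a1; rewrite a1 andbT rcons_cat /= -/(psi e) => E.
move: E => /eqP; rewrite eqseq_cat ?size_nseq // eqxx /= => /eqP[].
case: u un => [|b u] un /=.
  by case: e => //= ax _; have -> : a = x + ~~ l + ~~ r by lia.
(* If [1 < b], the 1 between [a] and [b] comes from the filling: no triangle is glued here. *)
have [b1|b1] := boolP (1 < b).
  case: e => [_ /(congr1 size)/=|y e ax yu /= A].
    by rewrite size_rcons /=; lia.
  rewrite -cat_rcons; apply: (IH true _ y e) => //=; first by rewrite b1.
  by rewrite addn0 cat_rcons; have -> : a = x + ~~ l by lia.
(* Otherwise [b] is 1 and is an ear of the cycle: a triangle is glued between [x] and the next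
   entry. *)
rewrite -/(psi e) /= => ax [b1' ]; case: e => [|y e] yu; first by case: (fill _ _ u) yu.
rewrite /= => A.
have -> : p ++ [:: a, b & u] = (p ++ [:: a; b]) ++ u by rewrite -catA.
apply: (IH false _ y e) => //.
- by move: un => /=; lia.
- by case: u yu {un} => //= c u; case: ifP => // c1 -[cy]; rewrite cy in c1.
have -> : a = (x + ~~ l).+1 by lia.
rewrite -catA b1' /=; case: e A {yu} => [|z e] /= A; rewrite addn1 ?addSn;
by apply: calA_glue.
Qed.

Lemma fill_psi_head l r t e : e != [::] -> rcons (fill l r t) 1 = psi e ->
  head false (bigs t).
Proof.
case: e => // x e _; case: t => //= a t; case: ifP => //.
by rewrite andbF => /negbT + [ax]; rewrite ax.
Qed.

(** After alignment only the wrap-around edge needs care: it is free if [1 < a], and otherwise [a]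
    is the ear 1 glued to it. *)
Lemma calA_cyc_fill s e :
  calA (cls e) -> cls (cyc_fill s) = cls (psi e) -> calA (cls s).
Proof.
move=> Ae; have := calA_size _ Ae; case: e Ae => // x; case/lastP => // m y Ae _.
case/cyc_fill_align => // -[|a t] /clsP-> //; rewrite /cyc_fill /=.
have [a1|a1] := boolP (1 < a).
  case lt: (last _ _) => /= -[]; last by case: (a) a1 => [|[]] // b _ /eqP; rewrite addn0.
  move=> ax tE; apply: (unfill_calA true true [::] x (rcons m y) (a :: t)) => //.
    by rewrite /= a1 /= ax tE.
  by rewrite !addn0 -lastI.
rewrite andbF => -[-> tE].
apply: (unfill_calA false false [:: 1] x (rcons m y)) => //.
  exact: fill_psi_head _ tE.
by rewrite /= last_rcons belast_rcons !addn1; exact: calA_glue_wrap.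
Qed.

(** * Cutting the ears off a quiddity cycle *)

Lemma psi_gt0 s : 0 \notin psi s.
Proof. by elim: s => //= a s IH; rewrite !inE. Qed.

Lemma calA_dihedral s t : dihedral s t -> calA (cls s) -> calA (cls t).
Proof. by move=> /clsP->. Qed.

Lemma fill_rcons l r s z :
  fill l r (rcons s z) =
  rcons (fill l (1 < z) s ++ nseq (last l (bigs s) && (1 < z)) 1)
        (if 1 < z then z + last l (bigs s) + r else z).
Proof. by rewrite -cats1 fill_cat /= catA cats1. Qed.

(* The new entry 2 pushes the ear 1 inwards, so that [psi] of the core gains
   the block [:: 3; 1]: the core itself gains an ear. *)
Lemma cyc_fill_ear b t e :
  calA (cls e) -> cls (cyc_fill [:: 1, b & t]) = cls (psi e) ->
  exists e', calA (cls e') /\ cls (cyc_fill [:: 2, 1, b.+1 & t]) = cls (psi e').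
Proof.
move=> Ae; have -> : cyc_fill [:: 1, b & t] = 1 :: fill false false (b :: t).
  by rewrite /cyc_fill /= andbF.
move=> /esym/clsP/dihedral_psi1[e1 /calA_dihedral/(_ Ae) Ae1 E1].
have := calA_size _ Ae1; case: e1 Ae1 E1 => // x; case/lastP => // m y Ae1 E1 _.
have /= b1 : head false (bigs (b :: t)).
  by apply: (fill_psi_head false false _ (x :: rcons m y)) => //; rewrite -E1.
exists (1 :: x.+1 :: rcons m y.+1); split; first exact: calA_glue_wrap.
move: E1; rewrite -[psi (_ :: _)]/([:: x.+2, 1 & psi (rcons m y)]).
rewrite psi_rcons /= b1 => -[].
case/lastP: t => [|t z]; first by move=> _ /(congr1 size); rewrite /= size_cat addnC.
have hE r : head r (bigs (rcons t z)) = head false (bigs (rcons t z)) by case: (t).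
have -> : [:: y.+2; 1] = rcons [:: y.+2] 1 by [].
rewrite -rcons_cat -rcons_cons !fill_rcons addn0 => bx /rcons_inj[].
rewrite -[1 :: psi m ++ [:: y.+2]]/((1 :: psi m) ++ [:: y.+2]) cats1.
move=> /rcons_inj[tm zy].
have z1 : 1 < z by move: zy; case: ifP => // /negbT + zy; rewrite -zy.
move: tm zy; rewrite z1 andbT => tm zy.
rewrite /cyc_fill -!rcons_cons /bigs map_rcons last_rcons -/(bigs _) z1.
rewrite !rcons_cons /= (ltnW b1 : 1 < b.+1) hE fill_rcons z1 andbT -tm.
rewrite -[psi [:: _, _ & _]]/([:: 3, 1, x.+3, 1 & psi (rcons m y.+1)]) psi_rcons.
have -> : b.+1 + 0 + head false (bigs (rcons t z)) = x.+3 by lia.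
have -> : z + last true (bigs t) + (1 < 2) = y.+3 by lia.
by rewrite -(cls_rot 1) rot1_cons !rcons_cons -!cats1 -catA.
Qed.

Lemma mem_fill l r s x : x <= 1 -> x \in s -> x \in fill l r s.
Proof.
move=> x1; elim: s l => //= a s IH l; rewrite mem_cat !inE.
case/predU1P => [<-|/IH->]; last by rewrite !orbT.
by rewrite ltnNge x1 eqxx orbT.
Qed.

Lemma cls_swap2 a b s : cls [:: a, b & s] = cls [:: b, a & rev s].
Proof.
by rewrite -cls_rev !rev_cons -(cls_rot (size (rev s))) -!cats1 -catA rot_size_cat.
Qed.

Lemma cls_swap3 a b c s : cls [:: a, b, c & s] = cls [:: c, b, a & rev s].
Proof.
by rewrite -cls_rev !rev_cons -(cls_rot (size (rev s))) -!cats1 -!catA rot_size_cat.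
Qed.

Lemma cls_nseq n x s : cls s = cls (nseq n x) -> s = nseq n x.
Proof.
move/esym/clsP/dihedral_perm => sn.
have := perm_size sn; rewrite size_nseq => <-; apply/all_pred1P.
by rewrite (perm_all _ sn) all_pred1_nseq.
Qed.

(** Induction on glueing. Between two entries greater than 1, glueing is a replacement of [delta]
    and keeps the core [e]; next to an ear it enlarges the core by [cyc_fill_ear], used on a
    reversed representative when the ear is [b]. *)
Lemma calA_delta C : calA C ->
  [\/ C = cls [:: 0; 0], C = cls [:: 1; 1; 1] |
    exists e, calA (cls e) /\ delta C = cls (psi e)].
Proof.
elim=> [|a b s _ [/(cls_nseq 2)[-> -> ->]|/(cls_nseq 3)[-> -> ->]|[e [Ae]]]].
- by constructor 1.
- by constructor 2.
- by constructor 3; exists [:: 0; 0]; split; [exact: calA_base | rewrite delta_cls].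
rewrite delta_cls => E; constructor 3; rewrite delta_cls.
(* Entries at most 1 survive filling, and [psi e] contains no 0. *)
have one x : x <= 1 -> x \in [:: a, b & s] -> x = 1.
  move=> x1 xs; have /clsP/dihedral_perm/perm_mem := E.
  move=> /(_ x); rewrite [RHS]mem_fill //.
  by case: x x1 xs => [|[]] // _ _; rewrite (negbTE (psi_gt0 _)).
have [a1|/one a1] := ltnP 1 a; last first.
  move: E; rewrite a1 ?mem_head // => E; exact: cyc_fill_ear _ _ _ Ae E.
have [b1|/one b1] := ltnP 1 b.
  exists e; split=> //; rewrite -E /cyc_fill.
  have := fill_mid (last true (bigs s)) true [::] s a1 b1.
  by rewrite /= b1 a1 (ltnW b1 : 1 < b.+1) (ltnW a1 : 1 < a.+1) => ->.
move: E; rewrite b1 ?inE ?eqxx ?orbT // => E.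
have [|e' [Ae' E']] := cyc_fill_ear a (rev s) e Ae _.
  by rewrite -E -!delta_cls cls_swap2 revK.
by exists e'; rewrite -E' -!delta_cls cls_swap3.
Qed.

(** * Preimages under [rho] of a window of [psi] *)

(** A 1 of the window is kept in [f'] if it is an entry of [S], and left to the replacements if it
    was inserted. The condition on heads gives the entry before [f'] the same increment as before
    [S], as the induction requires. *)
Lemma fill_window r S f v : fill true r S = 1 :: psi f ++ v ->
  exists f' S', [/\ S = f' ++ S', fill_full true true f' = 1 :: psi f &
    head false (bigs S) = head true (bigs f')].
Proof.
have [n] := ubnP (size S); elim: n S f => // n IH [|a S] // [|x f] Sn.
  have [a1 _|a1] := boolP (1 < a); first by exists [::], (a :: S).
  by rewrite /= (negbTE a1) => -[-> _]; exists [:: 1], S.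
have hS t : fill true r t = 1 :: psi f ++ v -> head r (bigs t) = head false (bigs t).
  by case: t.
rewrite /=; case: ifP => [a1 [ax]|a1 [a1']] /=.
  rewrite -/(psi f) => /[dup] /hS hS' /IH[//|f' [S' [SE f'E hE]]].
  exists (a :: f'), S'; split; rewrite /= ?SE //= /fill_full /= a1 //.
  by rewrite -hE -hS' ax; congr [:: _, _ & _]; exact: f'E.
case: S Sn => // b S Sn; rewrite /= a1' /=.
case: ifP => [b1 [bx]|b1 [bx]]; last by rewrite bx in b1.
rewrite -/(psi f) => /[dup] /hS hS' /IH[|f' [S' [SE f'E hE]]]; first exact: ltnW.
exists [:: 1, b & f'], S'; split; rewrite /= ?SE //= /fill_full /= b1 /=.
by rewrite -hE -hS' bx; congr [:: _, _ & _]; exact: f'E.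
Qed.

Lemma size_fill_l l r l' r' s :
  size (fill l r s) + (l' && head false (bigs s)) =
  size (fill l' r' s) + (l && head false (bigs s)).
Proof.
elim: s l l' => [|a s IH] l l' /=; first by rewrite !andbF.
have /addIn sE := IH (1 < a) (1 < a).
by rewrite !size_cat /= !size_nseq sE; lia.
Qed.

Lemma size_psi s : size (psi s) = (size s).*2.
Proof. by elim: s => //= a s ->. Qed.

Lemma sumn_fill l r s : sumn s <= sumn (fill l r s).
Proof.
elim: s l => //= a s IH l; rewrite sumn_cat /=.
by have := IH (1 < a); case: ifP => _; lia.
Qed.

Lemma count_fill l r s : count (ltn 1) (fill l r s) = count (ltn 1) s.
Proof.
elim: s l => //= a s IH l; rewrite count_cat /= IH count_nseq /=.
by congr (_ + _); case: ifP; lia.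
Qed.

Lemma count_psi s : count (ltn 1) (psi s) = size s.
Proof. by elim: s => //= a s ->. Qed.

Lemma fill_all_big s : all (ltn 1) s -> fill_full true true s = 1 :: psi s.
Proof.
elim: s => // a s IH /= /andP[a1 /[dup] s1 /IH].
rewrite /fill_full /= a1 /= => ->; congr [:: 1, _ & _].
by case: s s1 {IH} => [_|b s /= /andP[-> _]] /=; lia.
Qed.

(** Filling preserves the number of entries greater than 1, so [g] has [size f] of them, and a 1
    besides. *)
Lemma rho_psi_preimage g f : rho g = 1 :: psi f -> 1 \in f ->
  1 \in g /\ size f < size g.
Proof.
rewrite rhoE; case: g => // a g; set s := a :: g; rewrite /= -/s => sf f1.
have cs : count (ltn 1) s = size f.
  rewrite -(count_fill true true) -count_psi.
  have := congr1 (count (ltn 1)) sf.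
  by rewrite /fill_full count_cat count_nseq /= add0n => <-; rewrite addn0.
suff s1 : 1 \in s.
  split=> //; have : 0 < count (predC (ltn 1)) s.
    by rewrite -has_count; apply/hasP; exists 1.
  by have := count_predC (ltn 1) s; rewrite cs /=; lia.
(* Without a 1, all entries of [s] exceed 1, since a 0 would survive in [psi f]. Then every gap is
   filled and [s = f], which contains a 1. *)
apply/negPn/negP => s1.
have : all (ltn 1) s.
  apply/allP => x xs; rewrite /= ltnNge; apply/negP => x1.
  have : x \in 1 :: psi f by rewrite -sf mem_cat mem_fill.
  rewrite inE; case: x x1 xs => [|[|//]] _ xs; last by rewrite xs in s1.
  by rewrite (negbTE (psi_gt0 _)).
by move/fill_all_big; rewrite sf => -[/psi_inj fs]; rewrite -fs f1 in s1.
Qed.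

Lemma finite_size_sumn n m :
  finite_set [set s : seq nat | size s <= n /\ sumn s <= m].
Proof.
elim: n => [|n IH].
  by apply: sub_finite_set (finite_set1 [::]) => -[|a s] [].
pose A := [set x : nat | x <= m].
have Af : finite_set A by apply: sub_finite_set (finite_II m.+1) => x /=.
have : finite_set ([set a :: s | a in A & s in [set s | size s <= n /\ sumn s <= m]]
    `|` [set [::]]).
  by rewrite finite_setU; split; [exact: finite_image2 | exact: finite_set1].
apply: sub_finite_set.
move=> [|a s] /= [sn sm]; [by right|left; exists a; first by rewrite /A /=; lia].
by exists s => //=; lia.
Qed.

(** * Lifting windows, possibly winding around the cycle *)

Lemma nth_rep (s : seq nat) N j : j < N * size s ->
  nth 0 (flatten (nseq N s)) j = nth 0 s (j %% size s).
Proof.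
elim: N j => // N IH j; rewrite mulSn /= nth_cat => jN.
case: ltnP => sj; first by rewrite modn_small.
rewrite IH; first by rewrite -{2}(subnK sj) modnDr.
by rewrite ltn_subLR.
Qed.

(** At each seam the neighbours are the last and first entries of [t], just as in the cycle. *)
Lemma fill_rep N t :
  fill (last false (bigs t)) (head false (bigs t)) (flatten (nseq N t)) =
  flatten (nseq N (cyc_fill t)).
Proof.
have [->|t0] := eqVneq t [::]; first by elim: N.
elim: N => //= N IH; rewrite fill_cat.
have -> b : last b (bigs t) = last false (bigs t) by case: (t) t0.
have -> b : head (head b (bigs t)) (bigs (flatten (nseq N t))) = head b (bigs t).
  by case: N {IH} => //= N; case: (t) t0.
by rewrite IH.
Qed.

Lemma psi_cat s t : psi (s ++ t) = psi s ++ psi t.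
Proof. by rewrite /psi map_cat flatten_cat. Qed.

Lemma psi_rep N e : psi (flatten (nseq N e)) = flatten (nseq N (psi e)).
Proof. by elim: N => //= N IH; rewrite psi_cat IH. Qed.

(** A leading 1 is either inserted, and then [l] holds, or the first entry of [s], and then nothing
    is inserted before it. *)
Lemma fill_true l r s w : fill l r s = 1 :: w -> fill true r s = 1 :: w.
Proof.
case: s => //= a s; case: ifP; last by rewrite !andbF.
by case: l => // a1 [] /=; case: a a1 => [|[]] // a _ /eqP; rewrite addn0.
Qed.

Lemma contained_prefix f e : e != [::] -> contained f (cls e) ->
  exists e' N g, [/\ cls e' = cls e, g != [::], 0 < N &
    flatten (nseq N e') = f ++ g].
Proof.
move=> e0 [c /[dup] /dihedral_size ce /clsP ec [k fk]].
(* One copy more than [size f] leaves a nonempty remainder [g], since [c] is nonempty. *)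
pose e' := rot (k %% size c) c; pose N := (size f).+1.
have c0 : 0 < size c by rewrite ce lt0n size_eq0.
have kc : k %% size c < size c by rewrite ltn_mod.
have eN : size (flatten (nseq N e')) = N * size c.
  by rewrite size_flatten /shape map_nseq sumn_nseq size_rot mulnC.
have fN : size f < N * size c by rewrite /N; nia.
exists e', N, (drop (size f) (flatten (nseq N e'))); split=> //.
- by rewrite cls_rot.
- by rewrite -size_eq0 size_drop eN subn_eq0 -ltnNge.
rewrite -[LHS](cat_take_drop (size f)); congr (_ ++ _).
have sT : size (take (size f) (flatten (nseq N e'))) = size f.
  by rewrite size_takel // eN ltnW.
apply: (@eq_from_nth _ 0) => [|j]; rewrite sT // => jf.
rewrite nth_take // nth_rep ?size_rot; last exact: ltn_trans fN.
rewrite fk // /e' /rot nth_cat size_drop.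
have jc : j %% size c < size c by rewrite ltn_mod.
rewrite -modnDm; move: (k %% _) (j %% _) kc jc => K J Kc Jc; case: ltnP => jk.
  by rewrite nth_drop modn_small //; lia.
rewrite nth_take; last by lia.
congr nth; rewrite -[X in X %% _](subnK (_ : size c <= _)) ?modnDr ?modn_small; lia.
Qed.

Lemma window_lift s e f : 0 < size e -> f != [::] ->
  cls (cyc_fill s) = cls (psi e) -> properly_contained f (cls e) ->
  exists f', [/\ f' != [::], rho f' = 1 :: psi f & properly_contained f' (cls s)].
Proof.
rewrite lt0n size_eq0 => e0 f0 se [fe nfe].
have [e1 [N [g [ee1 g0 N0 fg]]]] := contained_prefix _ _ e0 fe.
have {e0} e10 : e1 != [::].
  by apply/eqP => E; case: (f) f0 fg => // a w _; rewrite E; elim: (N).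
move: se; rewrite -psibar_cls -ee1 psibar_cls => se.
have [t st tE] := cyc_fill_align _ _ e10 se.
have : exists v, fill (last false (bigs t)) (head false (bigs t)) 
    (flatten (nseq N t)) = 1 :: psi f ++ v.
  (* The last 1 of the unrolled cycle is missing from [fill]; as [g] is nonempty, it is taken from
     [psi g] and not from [psi f]. *)
  have [h hE] : exists h, psi g = rcons h 1.
    case/lastP: (g) g0 => // g1 z _; rewrite psi_rcons.
    exists (rcons (psi g1) z.+2); by rewrite -cats1 cat_rcons.
  exists h; rewrite fill_rep; apply: (@rcons_injl _ 1).
  rewrite rcons_cons rcons_cat -hE -psi_cat -fg psi_rep.
  by elim: (N) => //= M IH; rewrite rcons_cat IH -cat_rcons tE.
case=> v /fill_true/fill_window[f' [S' [tf' f'E _]]].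
have f'0 : f' != [::] by case: (f') f'E f0 => //=; case: (f).
have rf : rho f' = 1 :: psi f by rewrite rhoE; case: (f') f'0 f'E.
exists f'; split=> //; split.
  exists t => //; exists 0 => j jf.
  have <- := nth_rep t N; first by rewrite tf' nth_cat jf.
  have := congr1 size tf'; rewrite size_cat size_flatten /shape map_nseq sumn_nseq; lia.
(* If [f'] represented [s], lengths would give [size f = size e1], so that the prefix [f] is
   [e1]. *)
move=> sf'; apply: nfe.
have : size (cyc_fill f') = size (psi e1).
  apply/dihedral_size/clsP; rewrite -se -!delta_cls.
  by congr delta; apply/clsP.
have := congr1 size f'E; rewrite /fill_full size_cat /= size_nseq !size_psi.
rewrite /cyc_fill; set l := last false _; set h := head false _.
have -> : last true (bigs f') = l by rewrite /l; case: (f') f'0.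
have := size_fill_l l h true true f'; rewrite -/h => s1 s2 s3.
(* The cyclic filling of [f'] has twice [size f] entries, or one more if [l] and [h] are both false;
   parity excludes the latter. *)
have {s1 s2 s3} sfe : size f = size e1.
  by move: s1 s2 s3; case: (l); case: (h) => /=; lia.
have [fe1 _] : f = e1 /\ g = flatten (nseq N.-1 e1).
  move/eqP: fg; rewrite -(prednK N0) /= eq_sym eqseq_cat //.
  by case/andP => /eqP-> /eqP->.
by rewrite fe1 -ee1; exact: dihedral_refl.
Qed.

(** * Finite fibres and existence of the minima *)

(** Filling lowers neither length nor sum, so both are bounded on the fibre. *)
Lemma finite_delta_fiber C : finite_set [set D | calD D /\ delta D = psibar C].
Proof.
set w := psi (xget [::] C).
apply: sub_finite_set (finite_image cls (finite_size_sumn (size w) (sumn w))).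
move=> _ [[s _ <-]]; rewrite delta_cls => /esym/clsP/dihedral_perm sw.
exists s => //=; rewrite -(perm_size sw) -(perm_sumn sw); split.
  exact: size_fill.
exact: sumn_fill.
Qed.

Lemma finite_rho_fiber w : finite_set [set s | rho s = w].
Proof.
apply: sub_finite_set (finite_size_sumn (size w) (sumn w)) => s /= <-.
rewrite rhoE; split; first exact: size_rho_nf.
by case: s => // a s; rewrite sumn_cat (leq_trans (sumn_fill true true _)) ?leq_addr.
Qed.

(** This forces [F] to be nonempty, so that its minimal length exists. *)
Lemma infinite_calA : infinite_set calA.
Proof.
move=> A_fin; apply: infinite_nat.
have /sub_finite_set : [set: nat] `<=` (fun C => (size (xget [::] C)).-2) @` calA.
  move=> n _; suff [a [b [s [As <-]]]] : exists a b s,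
      calA (cls [:: a, b & s]) /\ size s = n.
    by exists (cls [:: a, b & s]) => //=; rewrite (dihedral_size (xget_cls _)).
  elim: n => [|n [a [b [s [As sn]]]]].
    by exists 0, 0, [::]; split=> //; exact: calA_base.
  by exists a.+1, 1, (b.+1 :: s); split; [exact: calA_step | rewrite /= sn].
by apply; exact: finite_image.
Qed.

Lemma rho_psi f : rho (1 :: psi f) = 1 :: psi f.
Proof.
rewrite rhoE /= /fill_full /=.
have -> : last false (bigs (psi f)) = false.
  by case/lastP: f => // f x; rewrite psi_rcons /bigs map_cat last_cat.
by rewrite cats0; congr (1 :: _); elim: f => //= x f ->; rewrite !addn0.
Qed.

Lemma ex_is_min (S : set nat) : S !=set0 -> exists m, is_min S m.
Proof.
move=> [n Sn]; have exS : exists n, `[< S n >] by exists n; apply/asboolP.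
exists (ex_minn exS); case: ex_minnP => m /asboolP Sm le_m; split=> // k Sk.
by apply: le_m; apply/asboolP.
Qed.

Theorem theorem2p10 (E : set (set (seq nat))) (F : set (seq nat))
  (E_sub : E `<=` calA) (F_sub : F `<=` calF)
  (E_fin : finite_set E) (F_fin : finite_set F)
  (E1 : property1 E) (EF2 : property2 E F) (F3 : property3 F) :
  let E' := E `|` delta_preimage (psibar @` E) in
  let F' := rho_preimage (iota_map @` (psi @` F)) in
  (finite_set E' /\ finite_set F') /\
  (E' `<=` calA /\ F' `<=` calF) /\
  (property1 E' /\ property2 E' F' /\ property3 F') /\
  exists m m', is_min (size @` F) m /\ is_min (size @` F') m' /\ m < m'.
Proof.
move=> E' F'.
have F'P g : F' g -> exists2 f, F f & 1 \in g /\ size f < size g.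
  move=> [_ [_ [f Ff <-] /esym gf]]; exists f => //.
  exact: rho_psi_preimage gf (F3 _ Ff).
split; [split|split; [split|split; [split; [|split]|]]].
- rewrite finite_setU; split=> //.
  apply: sub_finite_set (bigcup_finite E_fin (fun C _ => finite_delta_fiber C)).
  by move=> D [[DD _] [C EC CD]]; exists C.
- apply: sub_finite_set (bigcup_finite F_fin (fun f _ => finite_rho_fiber (1 :: psi f))).
  by move=> g [_ [_ [f Ff <-] gf]]; exists f.
- move=> C [/E_sub //|[[[s _ <-] _] [D /E_sub AD]]].
  have [e [De _]] := calA_cls D AD; move: AD.
  rewrite De psibar_cls delta_cls => Ae /esym; exact: calA_cyc_fill Ae.
- by move=> g [].
- by move=> C /E1; left.
- move=> C AC; have [->|->|[e [Ae Ce]]] := calA_delta C AC.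
  + by left; left; apply: E1; left.
  + by left; left; apply: E1; right.
  have [s [Cs s1]] := calA_cls C AC.
  (* Outside [E], the cycle [C] is neither of the two exceptional ones, hence lies in
     [dom_delta]. *)
  have [EC|nEC] := pselect (E C); first by left; left.
  have [Ee|[f Ff fe]] := EF2 _ Ae.
    left; right; split; last by exists (cls e); rewrite ?psibar_cls.
    split; first by exists s; [case: (s) s1 | rewrite Cs].
    by case=> CE; apply: nEC; apply: E1; [left|right].
  right; move: Ce; rewrite Cs delta_cls => Ce.
  have [||f' [f'0 rf ps]] := window_lift s e f _ _ Ce fe.
  + exact: ltnW (calA_size _ Ae).
  + exact/F_sub.
  by exists f' => //; split=> //; rewrite rf; exists (psi f) => //; exists f.
- by move=> g /F'P[f _ []].
have [f0 Ff0] : F !=set0.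
  apply/set0P/negP => /eqP F0; apply: infinite_calA.
  apply: sub_finite_set E_fin => C /EF2[//|[f]]; by rewrite F0.
have [m m_min] : exists m, is_min (size @` F) m.
  by apply: ex_is_min; exists (size f0), f0.
have [m' m'_min] : exists m', is_min (size @` F') m'.
  (* The sequence [1 :: psi f0] is already in normal form, so it belongs to [F']. *)
  apply: ex_is_min; exists (size (1 :: psi f0)), (1 :: psi f0) => //.
  split=> //; exists (psi f0); first by exists f0.
  by rewrite rho_psi.
exists m, m'; split=> //; split=> //.
case: m'_min => -[g /F'P[f Ff [_ fg]] <-] _; apply: leq_ltn_trans fg.
by apply: m_min.2; exists f.
Qed.
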